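(* Let $a,b,c$ be distinct vertices of $V$, and suppose the transition probabilities satisfy $p(b,a)=p(c,a)=1$ with $d(b)=d(c)=1$ and $b^{(1)}=c^{(1)}=a$. Let $h(v):=\mathbb{P}_v(T_b<T_c)$. Suppose that $$K_1:=1+\frac12\sum_{u\in V\setminus\{b,c\},\ v\in V} d(u)\,p(u,v)\,|h(u)-h(v)|$$ is finite, that $p$ is irreducible, and that $\limsup_{v\in V}h(v)=0$ (i.e. for every $\epsilon>0$ there are only finitely many $v\in V$ with $h(v)>\epsilon$). Then for any transfinite rotor walk started at $a$, and any transfinite time $\tau=m\omega+t$ at which all vertices have been visited only finitely often (i.e. $n_\tau(v)<\infty$ for all $v$) and with $n_\tau(b)+n_\tau(c)+m>0$, $$\left| h(a)-\frac{n_\tau(b)}{n_\tau(b)+n_\tau(c)+m}\right|\leq \frac{K_1}{n_\tau(b)+n_\tau(c)+m}.$$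
   Context: Markov chain: $V$ is a countable set and $p:V\times V\to[0,1]$ are the transition probabilities of a Markov chain $X_0,X_1,\ldots$ on $V$; all $p(u,v)$ are rational, and for each $u$ there are only finitely many $v$ with $p(u,v)>0$. $\mathbb{P}_u$ is the law of the chain started at $X_0=u$. $T_v:=\min\{t\ge 0: X_t=v\}$, with $\min\emptyset:=\infty$. Rotor mechanism: to each vertex $u$ are associated a positive integer $d(u)$ and a finite sequence of (not necessarily distinct) vertices $u^{(1)},\ldots,u^{(d(u))}$ (the successors of $u$) such that $p(u,v)=\#\{i:u^{(i)}=v\}/d(u)$ for all $u,v\in V$. Rotor walk: a rotor configuration is a map $r$ assigning to each $v\in V$ an integer $r(v)\in\{1,\ldots,d(v)\}$. Given an initial vertex $x_0$ and an initial rotor configuration $r_0$, the rotor walk is defined inductively: $r_{t+1}(v)=r_t(v)$ for $v\ne x_t$; $r_{t+1}(x_t)=r_t(x_t)+1$ if $r_t(x_t)<d(x_t)$ and $r_{t+1}(x_t)=1$ if $r_t(x_t)=d(x_t)$; and $x_{t+1}:=(x_t)^{(r_{t+1}(x_t))}$. A rotor walk is recurrent if it visits every vertex infinitely often, transient if it visits every vertex only finitely often; for an irreducible chain every rotor walk is one or the other. Transfinite rotor walk started at $a$: fix an initial rotor configuration $r_0$ and set $x_0=a$. If the rotor walk $x_0,x_1,\ldots$ is transient, set $r_\omega(v):=\lim_{t\to\infty}r_t(v)$, $x_\omega:=a$, and run the rotor walk $x_\omega,x_{\omega+1},\ldots$ from $(x_\omega,r_\omega)$ by the usual rules; if this is again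 transient set $r_{2\omega}:=\lim_{t\to\infty} r_{\omega+t}$, $x_{2\omega}:=a$, and so on. Continue up to the first $m$ for which the walk $x_{m\omega},x_{m\omega+1},\ldots$ is recurrent (after which no further restart is made), or indefinitely if it is transient for all $m$. Transfinite times are $\omega^2$ and $m\omega+t$ with $m,t$ non-negative integers, ordered lexicographically by $(m,t)$, with $m\omega+t<\omega^2$. For a transfinite time $\tau$, $n_\tau(v):=\#\{\alpha<\tau: x_\alpha=v\}$ (over times $\alpha$ at which the walk is defined). *)

(* Defs.v *)
From HB Require Import structures.
From mathcomp Require Import all_boot all_order all_algebra finmap.
From mathcomp Require Import all_classical all_reals all_analysis.

Set Implicit Arguments.
Unset Strict Implicit.
Unset Printing Implicit Defensive.

Import Order.TTheory GRing.Theory Num.Theory.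
Import numFieldNormedType.Exports.

Local Open Scope classical_set_scope.
Local Open Scope ring_scope.

Section MarkovChain.
Context {R : realType} {V : countType}.
Implicit Types (p : V -> V -> R) (u v : V).

(* The row sum is a finitely supported sum: it is meaningful thanks to the
   finiteness clause before it. *)
Definition transition_probabilities p : Prop :=
  [/\ forall u v, 0 <= p u v <= 1,
      forall u v, exists q : rat, p u v = ratr q,
      forall u, finite_set [set v | 0 < p u v] &
      forall u, \sum_(v \in [set: V]) p u v = 1].

Fixpoint step_probability p (n : nat) u v : R :=
  if n is n'.+1 then \sum_(w \in [set: V]) p u w * step_probability p n' w v
  else (u == v)%:R.

Definition irreducible p : Prop :=
  forall u v, exists n, 0 < step_probability p n u v.

(* V carries the discrete sigma-algebra; being countable, measurability of the
   X_t amounts to that of the fibres. The last clause is the Markov property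
   P(X_{t+1} = x_{t+1} | X_0 = x_0, ..., X_t = x_t) = p(x_t, x_{t+1}), cleared
   of the conditioning. *)
Definition markov_chain (d : measure_display) (T : measurableType d)
    (P : probability T R) (X : nat -> T -> V) p u : Prop :=
  [/\ forall t v, measurable [set w | X t w = v],
      P [set w | X 0%N w = u] = 1%E &
      forall (x : nat -> V) (t : nat),
        (P [set w | forall i, (i <= t.+1)%N -> X i w = x i] =
         P [set w | forall i, (i <= t)%N -> X i w = x i]
           * (p (x t) (x t.+1))%:E)%E].

(* Extended-real valued, so that the infimum of the empty set is +oo. *)
Definition hitting_time (T : Type) (X : nat -> T -> V) v (w : T) : \bar R :=
  ereal_inf [set (t%:R)%:E | t in [set t | X t w = v]].

Definition hit_before (d : measure_display) (T : measurableType d)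
    (P : V -> probability T R) (X : nat -> T -> V) b c v : R :=
  fine (P v [set w | (hitting_time X b w < hitting_time X c w)%E]).

End MarkovChain.

(* A rotor mechanism is the map [succ] sending u to the list of its successors
   u^(1), ..., u^(d(u)); thus d(u) is the length of the list. Rotor positions
   are 1-based natural numbers. *)
Section RotorWalk.
Context {V : countType}.
Implicit Types (succ : V -> seq V) (r : V -> nat) (u v x : V).

Definition degree succ u : nat := size (succ u).

(* u^(i), meaningful for 1 <= i <= d(u) *)
Definition successor succ u (i : nat) : V := nth u (succ u) i.-1.

Definition rotor_mechanism {R : realType} succ (p : V -> V -> R) : Prop :=
  (forall u, (0 < degree succ u)%N) /\
  (forall u v, p u v = (count_mem v (succ u))%:R / (degree succ u)%:R).

Definition rotor_configuration succ r : Prop :=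
  forall v, (1 <= r v <= degree succ v)%N.

Definition rotor_update succ x r : V -> nat :=
  fun v => if v == x then
             if (r x < degree succ x)%N then (r x).+1 else 1%N
           else r v.

Definition rotor_step succ (s : V * (V -> nat)) : V * (V -> nat) :=
  let r' := rotor_update succ s.1 s.2 in (successor succ s.1 (r' s.1), r').

Definition rotor_walk succ x r (t : nat) : V * (V -> nat) :=
  iter t (rotor_step succ) (x, r).

Definition transient (x : nat -> V) : Prop :=
  forall v, finite_set [set t | x t = v].

(* [stage_config succ a r m] is r_{m omega}; the limits, taken in the discrete
   space nat, exist as long as the preceding stages are transient. *)
Fixpoint stage_config succ a r (m : nat) : V -> nat :=
  if m is m'.+1 then
    fun v => lim ((rotor_walk succ a (stage_config succ a r m') t).2 v
                    @[t --> \oo])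
  else r.

(* x_{m omega + t}, where the time m omega + t is the pair (m, t) in the
   lexicographic order *)
Definition transfinite_walk succ a r (tau : nat *l nat) : V :=
  (rotor_walk succ a (stage_config succ a r tau.1) tau.2).1.

(* The values of [transfinite_walk] after a non-transient stage are junk: the
   walk is never restarted there. *)
Definition walk_defined succ a r (tau : nat *l nat) : Prop :=
  forall k, (k < tau.1)%N ->
    transient (fun t => transfinite_walk succ a r (k, t)).

Definition visits succ a r (tau : nat *l nat) v : set (nat *l nat) :=
  [set alpha | [/\ (alpha < tau)%O, walk_defined succ a r alpha &
                   transfinite_walk succ a r alpha = v]].

(* n_tau(v); only meaningful when [visits] is finite *)
Definition nvisits succ a r (tau : nat *l nat) v : nat :=
  #|` fset_set (visits succ a r tau v)|.

End RotorWalk.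

Definition K1 {R : realType} {V : countType} (succ : V -> seq V)
    (p : V -> V -> R) (h : V -> R) (b c : V) : \bar R :=
  (1 + (2^-1)%:E *
    \esum_(uv in ~` [set b; c] `*` [set: V])
      ((degree succ uv.1)%:R * p uv.1 uv.2 * `|h uv.1 - h uv.2|)%:E)%E.

(* Main.v *)
Require Import Defs.
From mathcomp Require Import all_boot all_order all_algebra finmap.
From mathcomp Require Import all_classical all_reals all_analysis.
From mathcomp Require Import ring lra.

Set Implicit Arguments.
Unset Strict Implicit.
Unset Printing Implicit Defensive.

Import Order.TTheory GRing.Theory Num.Theory.
Import numFieldNormedType.Exports.

Local Open Scope classical_set_scope.
Local Open Scope ring_scope.

(* The function h is harmonic off {b, c}, so the increments h(u) - h(u^(i)) sum
   to zero over a full turn of the rotor at u. Give that rotor, in position k,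
   the potential sum_{i <= k} (h(u) - h(u^(i))); then h(x_t) plus the total
   rotor potential is constant along the walk, except that a visit to b adds
   h(a) - 1 and a visit to c adds h(a). Along a transient stage h(x_t) -> 0, so
   each restart at a adds h(a). Hence (n(b) + n(c) + m) h(a) - n(b) is
   h(x_tau) - h(a) plus the total change of rotor potential, and the potential
   of a single rotor varies by at most 1/2 sum_i |h(u) - h(u^(i))|.
   Since infinitely many rotors may move, the balance is made only over a finite
   set F of vertices, up to an error controlled by the tail of K_1 outside F. *)

(** * The probability of reaching [b] before [c], as a series over the time of the hit *)

Section HittingProbability.
Context {R : realType} {V : countType} (p : V -> V -> R) (succ : V -> seq V).
Hypothesis hsucc : rotor_mechanism succ p.
Variables b c : V.

Definition cylinder (T : Type) (X : nat -> T -> V) (x : nat -> V) (k : nat) :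
    set T :=
  [set w | forall i, (i <= k)%N -> X i w = x i].

(** Time is counted from [k], so that an induction on [n] can condition on longer and longer
    pasts. *)
Definition hits_after (T : Type) (X : nat -> T -> V) (k n : nat) : set T :=
  [set w | X (k + n)%N w = b /\
           forall i, (i < n)%N -> X (k + i)%N w \notin [:: b; c]].

(** Probability, from [v], that [b] is hit at time [n] with neither [b] nor [c] hit earlier.
    Averaging over the successor list rather than against [p] matches the form in which the rotors
    use harmonicity. *)
Fixpoint hit_prob (n : nat) (v : V) : R :=
  if n is n'.+1 then
    if v \in [:: b; c] then 0
    else (\sum_(w <- succ v) hit_prob n' w) / (degree succ v)%:R
  else (v == b)%:R.

Lemma hit_prob_ge0 n v : 0 <= hit_prob n v.
Proof.
elim: n v => [|n IH] v /=; first by rewrite ler0n.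
by case: ifP => // _; apply: divr_ge0; [exact: sumr_ge0|rewrite ler0n].
Qed.

Lemma sum_succ u (f : V -> R) :
  (\sum_(w <- succ u) f w) / (degree succ u)%:R =
  \sum_(w <- undup (succ u)) p u w * f w.
Proof.
rewrite -big_undup_iterop_count mulr_suml; apply: eq_bigr => w _.
by rewrite hsucc.2 mulrAC mulr_natl.
Qed.

Lemma transition_succ u w : w \notin succ u -> p u w = 0.
Proof. by move=> /count_memPn uw; rewrite hsucc.2 uw mul0r. Qed.

Context (d : measure_display) (T : measurableType d) (P : probability T R)
  (X : nat -> T -> V) (u : V).
Hypothesis hX : markov_chain P X p u.

Lemma measurable_state t (A : set V) : measurable [set w | A (X t w)].
Proof.
have -> : [set w | A (X t w)] =
    \bigcup_(v : V) (if `[< A v >] then [set w | X t w = v] else set0).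
  apply/seteqP; split=> [w /= Aw|w [v _]].
    by exists (X t w) => //; rewrite asboolT.
  by case: asboolP => //= Av ->.
apply: countable_bigcupT_measurable => // v.
by case: ifP => // _; case: hX.
Qed.

Lemma measurable_cylinder x k : measurable (cylinder X x k).
Proof.
have -> : cylinder X x k =
    \bigcap_i [set w | [set v | (i <= k)%N -> v = x i] (X i w)].
  apply/seteqP; split=> [w xw i _ ik|w xw i ik]; first exact: xw.
  exact: (xw i I ik).
by apply: bigcapT_measurable => i; exact: measurable_state.
Qed.

Lemma measurable_hits_after k n : measurable (hits_after X k n).
Proof.
have -> : hits_after X k n =
    [set w | [set v | v = b] (X (k + n)%N w)] `&`
    \bigcap_i [set w | [set v | (i < n)%N -> v \notin [:: b; c]]
                         (X (k + i)%N w)].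
  by apply/seteqP; split=> [w [wb wbc]|w [wb wbc]]; split=> // i;
    [move=> _ ik; exact: wbc|move=> ik; exact: (wbc i I ik)].
apply: measurableI; first exact: measurable_state.
by apply: bigcapT_measurable => i; exact: measurable_state.
Qed.

Let extend (x : nat -> V) k v i := if (i <= k)%N then x i else v.

Lemma cylinder_extend x k v :
  cylinder X (extend x k v) k.+1 = cylinder X x k `&` [set w | X k.+1 w = v].
Proof.
apply/seteqP; split=> [w xw|w [xw wv] i].
  split=> [i ik|]; first by rewrite (xw i (leqW ik)) /extend ik.
  by rewrite /= (xw k.+1 (leqnn _)) /extend ltnn.
rewrite /extend; case: (leqP i k) => [/xw//|ki ik].
by rewrite (_ : i = k.+1)//; apply/eqP; rewrite eqn_leq ik.
Qed.

Lemma prob_cylinder_extend x k v :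
  P (cylinder X (extend x k v) k.+1) = (P (cylinder X x k) * (p (x k) v)%:E)%E.
Proof.
case: hX => _ _ /(_ (extend x k v) k) -> .
rewrite /extend leqnn ltnn; congr (P _ * _)%E.
by apply/seteqP; split=> w /= xw i ik; have := xw i ik; rewrite ik.
Qed.

(** The Markov property speaks of one next state at a time; each non-successor has conditional
    probability zero, and [V] is countable, so the null events can be united along the enumeration
    [choice.unpickle]. *)
Lemma prob_cylinder_exit x k :
  P (cylinder X x k `&` [set w | X k.+1 w \notin succ (x k)]) = 0.
Proof.
apply: (measure_negligible (mu := P)).
  apply: measurableI; first exact: measurable_cylinder.
  exact: (measurable_state _ [set v | v \notin succ (x k)]).
pose F n := if choice.unpickle n is Some v then
    if v \in succ (x k) then set0 else cylinder X (extend x k v) k.+1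
  else set0.
have FN n : P.-negligible (F n).
  rewrite /F; case: (choice.unpickle n) => [v|]; last exact: negligible_set0.
  case: ifPn => [_|xv]; first exact: negligible_set0.
  exists (cylinder X (extend x k v) k.+1); split => //.
    exact: measurable_cylinder.
  by rewrite prob_cylinder_extend transition_succ// mule0.
apply: negligibleS (negligible_bigcup FN) => w [xw /= wk].
exists (choice.pickle (X k.+1 w)) => //.
by rewrite /F choice.pickleK (negbTE wk) cylinder_extend.
Qed.

(** First-step analysis: induction on [n] for all pasts at once, the next state being absorbed into
    a cylinder of length [k.+1]. *)
Lemma prob_cylinder_hits n x k :
  P (cylinder X x k `&` hits_after X k n) =
  (P (cylinder X x k) * (hit_prob n (x k))%:E)%E.
Proof.
elim: n x k => [|n IH] x k /=.
  have [xb|xb] := eqVneq (x k) b.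
    rewrite mule1; congr (P _); apply/setIidPl => w xw.
    by split=> //; rewrite addn0 (xw k (leqnn k)).
  rewrite mule0; apply/(@eq_trans _ _ (P set0)); last exact: measure0.
  congr (P _); apply/seteqP; split=> // w [xw [+ _]].
  by rewrite addn0 (xw k (leqnn k)) => /eqP; rewrite (negbTE xb).
case: ifPn => xbc.
  rewrite mule0; apply/(@eq_trans _ _ (P set0)); last exact: measure0.
  congr (P _); apply/seteqP; split=> // w [xw [_ /(_ 0%N isT)]].
  by rewrite addn0 (xw k (leqnn k)) xbc.
pose B v := cylinder X (extend x k v) k.+1 `&` hits_after X k.+1 n.
have mB v : measurable (B v).
  apply: measurableI; first exact: measurable_cylinder.
  exact: measurable_hits_after.
have tB : trivIset [set: V] B.
  apply/trivIsetP => v w _ _ vw; apply/seteqP; split=> // y [[yv _] [yw _]].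
  move: yv yw; rewrite !cylinder_extend => -[_ /= yv] [_ /= yw].
  by move: vw; rewrite -yv -yw eqxx.
pose S := [set` undup (succ (x k))].
have split_step : cylinder X x k `&` hits_after X k n.+1 `&`
    [set w | S (X k.+1 w)] = \bigcup_(v in S) B v.
  apply/seteqP; split=> [w [[xw [wb wbc]] wk]|w [v vk []]].
    exists (X k.+1 w) => //; split; first by rewrite cylinder_extend.
    by split=> [|i ik]; rewrite addSnnS//; exact: wbc.
  rewrite cylinder_extend => -[xw /= wv] [wb wbc].
  split; last by rewrite /= wv.
  split=> //; split=> [|[_|i ik]]; first by rewrite -addSnnS.
    by rewrite addn0 (xw k (leqnn k)).
  by rewrite -addSnnS; exact: wbc.
have mC : measurable (cylinder X x k `&` hits_after X k n.+1).
  apply: measurableI; first exact: measurable_cylinder.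
  exact: measurable_hits_after.
have mS : measurable [set w | S (X k.+1 w)] by exact: measurable_state.
rewrite (measureDI P mC mS) split_step measure_fin_bigcup//; first last.
- exact: sub_trivIset tB.
- exact: finite_seq.
(* The part of the event where the next state is not a successor is null, which leaves a finite sum
   over the distinct successors. *)
rewrite [X in (X + _)%E](_ : _ = 0%E); last first.
  apply: subset_measure0 (prob_cylinder_exit x k).
  - exact: measurableD.
  - apply: measurableI; first exact: measurable_cylinder.
    exact: (measurable_state _ [set v | v \notin succ (x k)]).
  - by move=> w [[xw _] /= Sw]; split=> //=; apply/negP; rewrite -mem_undup.
rewrite add0e -fsbig_seq ?undup_uniq// sum_succ -sumEFin.
rewrite ge0_sume_distrr; last first.
  move=> v _; rewrite lee_fin mulr_ge0 ?hit_prob_ge0// hsucc.2.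
  by rewrite divr_ge0 ?ler0n.
apply: eq_bigr => v _.
apply: etrans (IH (extend x k v) k.+1) _.
rewrite prob_cylinder_extend /extend ltnn.
by rewrite EFinM muleA.
Qed.

Hypothesis hbc : b != c.

(** The index of the union is the value of the hitting time of [b], necessarily finite on this
    event. *)
Lemma hits_before_cover :
  [set w | (hitting_time X b w < hitting_time X c w :> \bar R)%E] =
  \bigcup_n hits_after X 0 n.
Proof.
have hit_le v w n : X n w = v -> (hitting_time X v w <= n%:R%:E :> \bar R)%E.
  by move=> Xn; apply: ereal_inf_lbound; exists n.
have le_hit v w n : (forall i, (i < n)%N -> X i w != v) ->
    (n%:R%:E <= hitting_time X v w :> \bar R)%E.
  move=> Xn; apply: le_ereal_inf_tmp => _ [i Xi <-]; rewrite lee_fin ler_nat.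
  by rewrite leqNgt; apply/negP => /Xn; rewrite Xi eqxx.
apply/seteqP; split=> [w /= wbc|w [n _ [wb wbc]] /=].
  have [n /eqP wb] : exists n, X n w == b.
    apply: contrapT => wb; move: wbc; rewrite ltNge => /negP; apply.
    rewrite [leRHS](_ : _ = +oo%E) ?leey// /hitting_time.
    rewrite [X in ereal_inf X](_ : _ = set0) ?ereal_inf0//.
    by apply/seteqP; split=> // e [t /= tb _]; case: wb; exists t; rewrite tb.
  have exb : exists n, X n w == b by exists n; rewrite wb.
  (* [k] is the first hitting time of [b]; an earlier visit to [c] would contradict the order of the
     hitting times. *)
  case: (ex_minnP exb) => k /eqP kb kmin.
  exists k => //; split=> // i ik; rewrite !inE negb_or; apply/andP; split.
    by apply/negP => /kmin; rewrite leqNgt ik.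
  apply/eqP => ic; move: wbc; rewrite ltNge => /negP; apply.
  apply: (@le_trans _ _ i%:R%:E); first exact: hit_le.
  apply: le_hit => j ji; apply/negP => /kmin.
  by rewrite leqNgt (ltn_trans ji ik).
rewrite add0n in wb.
apply: (@le_lt_trans _ _ n%:R%:E); first exact: hit_le.
apply: (@lt_le_trans _ _ n.+1%:R%:E); first by rewrite lte_fin ltr_nat.
apply: le_hit => i; rewrite ltnS leq_eqVlt => /predU1P[->|/wbc].
  by rewrite wb.
by rewrite !inE negb_or => /andP[].
Qed.

Lemma measurable_hits_before :
  measurable [set w | (hitting_time X b w < hitting_time X c w :> \bar R)%E].
Proof.
rewrite hits_before_cover; apply: bigcupT_measurable => n.
exact: measurable_hits_after.
Qed.

(** The events [hits_after X 0 n] are disjoint, as [b] is first hit at only one time. The cylinder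
    fixing the state [u] at time 0 has probability one, so intersecting with it changes nothing. *)
Lemma prob_hits_before :
  P [set w | (hitting_time X b w < hitting_time X c w :> \bar R)%E] =
  \big[+%E/0%E]_(0 <= n <oo) (hit_prob n u)%:E.
Proof.
rewrite hits_before_cover measure_semi_bigcup.
- apply: eq_eseriesr => n _.
  have Pu : P (cylinder X (fun=> u) 0) = 1%E.
    case: hX => _ <- _; congr (P _).
    apply/seteqP; split=> [w xw|w /= wu [|//] _].
      exact: (xw 0%N isT).
    exact: wu.
  have mC := measurable_cylinder (fun=> u) 0.
  rewrite (measureDI P (measurable_hits_after 0 n) mC) setIC.
  rewrite [X in (_ + X)%E](_ : _ = (hit_prob n u)%:E); last first.
    by apply: etrans (prob_cylinder_hits n (fun=> u) 0) _; rewrite Pu mul1e.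
  rewrite [X in (X + _)%E](_ : _ = 0%E) ?add0e//.
  apply: (@subset_measure0 _ _ _ P _ (~` cylinder X (fun=> u) 0)).
  + by apply: measurableD => //; exact: measurable_hits_after.
  + exact: measurableC.
  + by move=> w [].
  + by apply: etrans (probability_setC P mC) _; rewrite Pu subee.
- exact: measurable_hits_after.
- apply/trivIsetP.
  have disj i j : (i < j)%N -> hits_after X 0 i `&` hits_after X 0 j = set0.
    move=> ij; apply/seteqP; split=> // w [[wi _] [_ /(_ i ij)]].
    by rewrite wi !inE eqxx.
  by move=> i j _ _; case: ltngtP => // ij _; [|rewrite setIC]; exact: disj.
- by apply: bigcupT_measurable => n; exact: measurable_hits_after.
Qed.
End HittingProbability.

(** * Boundary values and harmonicity of [h] *)

Section Harmonic.
Context {R : realType} {V : countType} (p : V -> V -> R) (succ : V -> seq V).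
Hypothesis hsucc : rotor_mechanism succ p.
Context (d : measure_display) (T : measurableType d)
  (P : V -> probability T R) (X : nat -> T -> V).
Hypothesis hX : forall u : V, markov_chain (P u) X p u.
Variables b c : V.
Hypothesis hbc : b != c.
Let h := hit_before P X b c.

Lemma hit_before_ge0 v : 0 <= h v.
Proof. exact: fine_ge0. Qed.

Lemma hit_before_EFin v :
  (h v)%:E =
  P v [set w | (hitting_time X b w < hitting_time X c w :> \bar R)%E].
Proof.
rewrite /h /hit_before fineK// fin_num_measure//.
exact: (measurable_hits_before (hX v) hbc).
Qed.

Lemma hit_before_le1 v : h v <= 1.
Proof.
rewrite -lee_fin hit_before_EFin; apply: probability_le1.
exact: (measurable_hits_before (hX v) hbc).
Qed.

Lemma hit_before_series v :
  (h v)%:E = \big[+%E/0%E]_(0 <= n <oo) (hit_prob succ b c n v)%:E.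
Proof. by rewrite hit_before_EFin (prob_hits_before hsucc (hX v) hbc). Qed.

Lemma hit_before_recl v :
  (h v)%:E = ((v == b)%:R%:E +
    \big[+%E/0%E]_(0 <= n <oo) (hit_prob succ b c n.+1 v)%:E)%E.
Proof.
rewrite hit_before_series nneseries_recl//; last first.
  by move=> k _; rewrite lee_fin hit_prob_ge0.
rewrite -(nneseries_addn 1); last by move=> k; rewrite lee_fin hit_prob_ge0.
by congr (_ + _)%E; apply: eq_eseriesr => k _; rewrite addn1.
Qed.

Lemma hit_before_at v : v \in [:: b; c] -> h v = (v == b)%:R.
Proof.
move=> vbc; apply: EFin_inj; rewrite hit_before_recl eseries0 ?adde0// => n _ _.
by rewrite /= vbc.
Qed.

(** Off [b] and [c] the term at time 0 vanishes and each later term is the successor average of the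
    preceding one; all terms are nonnegative, so the series and the finite average can be
    exchanged. *)
Lemma hit_before_harmonic v : v \notin [:: b; c] ->
  \sum_(w <- succ v) h w = (degree succ v)%:R * h v.
Proof.
move=> vbc; have d0 : (degree succ v)%:R != 0 :> R.
  by rewrite pnatr_eq0 -lt0n hsucc.1.
apply: (mulIf (invr_neq0 d0)); rewrite mulrAC mulfV// mul1r.
apply: EFin_inj; rewrite hit_before_recl.
move: (vbc); rewrite !inE negb_or => /andP[/negbTE-> _]; rewrite add0e.
under eq_eseriesr => n _ do rewrite /= (negbTE vbc) mulrC EFinM -sumEFin.
rewrite nneseriesZl; last first.
  by move=> n _; apply: sume_ge0 => w _; rewrite lee_fin hit_prob_ge0.
rewrite nneseries_sum; last by move=> w n _; rewrite lee_fin hit_prob_ge0.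
rewrite mulrC EFinM -sumEFin; congr (_ * _)%E.
by apply: eq_bigr => w _; rewrite hit_before_series.
Qed.
End Harmonic.

(** * Auxiliary facts on finite sets *)

Lemma sum_fsetU (M : nmodType) (I : choiceType) (F G : {fset I}) (f : I -> M) :
  \sum_(i <- (F `|` G)%fset) f i =
  \sum_(i <- F) f i + \sum_(i <- (G `\` F)%fset) f i.
Proof.
have FE : [fset i in (F `|` G)%fset | i \in F]%fset = F.
  apply/fsetP => i; rewrite !inE/= andb_orl andbb.
  by case: (i \in F); rewrite ?andbF.
have GE : [fset i in (F `|` G)%fset | i \notin F]%fset = (G `\` F)%fset.
  by apply/fsetP => i; rewrite !inE/= andb_orl andbN andbC.
by rewrite (big_fsetID _ [in F])/= FE GE.
Qed.

Lemma finite_nat_bounded (A : set nat) : finite_set A ->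
  exists N, forall n, (N <= n)%N -> ~ A n.
Proof.
move=> fA; exists (\max_(i <- fset_set A) i).+1 => n Nn An.
have : n \in fset_set A by rewrite in_fset_set// inE.
by move=> /(@leq_bigmax_seq _ _ predT id)/(_ isT); rewrite leqNgt Nn.
Qed.

(** * Rotor potentials and their balance along a single walk *)

Section RotorPotential.
Context {R : realType} {V : countType} (succ : V -> seq V) (h : V -> R).
Variables (a b c : V).
Hypothesis succ_gt0 : forall u, (0 < degree succ u)%N.
Hypothesis h_ge0 : forall v, 0 <= h v.
Hypothesis h_harmonic : forall u, u \notin [:: b; c] ->
  \sum_(v <- succ u) h v = (degree succ u)%:R * h u.
Hypothesis hb : h b = 1.
Hypothesis hc : h c = 0.
Hypothesis bc_neq : b != c.
Hypothesis degree_bc : forall u, u \in [:: b; c] -> degree succ u = 1%N.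
Hypothesis successor_bc : forall u, u \in [:: b; c] -> successor succ u 1 = a.

Definition rotor_potential (u : V) (k : nat) : R :=
  \sum_(v <- take k (succ u)) (h u - h v).

(** The value is 0 at [b] and [c], where the rotor has a single position and its potential never
    changes. *)
Definition half_variation (u : V) : R :=
  if u \in [:: b; c] then 0
  else 2^-1 * \sum_(v <- succ u) `|h u - h v|.

Lemma half_variation_ge0 u : 0 <= half_variation u.
Proof.
by rewrite /half_variation; case: ifP => // _; rewrite mulr_ge0// sumr_ge0.
Qed.

Lemma rotor_potential_turn u : u \notin [:: b; c] ->
  rotor_potential u (degree succ u) = 0.
Proof.
move=> ubc; rewrite /rotor_potential take_size sumrB h_harmonic//.
by rewrite big_const_seq count_predT iter_addr_0 mulr_natl subrr.
Qed.

(* The increments h(u) - h(v) sum to zero over a full turn of the rotor, so an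
   arc and its complement have opposite sums. *)
Lemma rotor_potential_bound u k l : u \notin [:: b; c] ->
  `|rotor_potential u k - rotor_potential u l| <= half_variation u.
Proof.
move=> ubc; wlog kl : k l / (l <= k)%N.
  by case: (leqP l k) => [|/ltnW] kl wl; last rewrite distrC; exact: wl.
pose s1 := take l (succ u); pose s2 := drop l (take k (succ u)).
pose s3 := drop k (succ u).
have ks : take k (succ u) = s1 ++ s2.
  by rewrite -[LHS](cat_take_drop l) take_takel.
have us : succ u = s1 ++ s2 ++ s3 by rewrite catA -ks cat_take_drop.
have := rotor_potential_turn ubc.
rewrite /rotor_potential /half_variation (negbTE ubc) take_size.
rewrite ks -/s1 us !big_cat/=.
have := ler_norm_sum s1 (fun v => h u - h v) predT.
have := ler_norm_sum s2 (fun v => h u - h v) predT.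
have := ler_norm_sum s3 (fun v => h u - h v) predT.
rewrite addrAC subrr add0r.
move: (\sum_(v <- s1) _) (\sum_(v <- s2) _) (\sum_(v <- s3) _).
move: (\sum_(v <- s1) _) (\sum_(v <- s2) _) (\sum_(v <- s3) _).
move=> n1 n2 n3 x1 x2 x3.
rewrite !ler_norml; lra.
Qed.

Lemma rotor_update_configuration x r :
  rotor_configuration succ r ->
  rotor_configuration succ (rotor_update succ x r).
Proof.
move=> hr v; rewrite /rotor_update; case: eqP => [->|//].
by case: (ltnP (r x)) => [//|_]; rewrite succ_gt0.
Qed.

(** The walk leaves along the updated rotor, so one increment is added to the partial sum. When the
    rotor wraps around to position 1, the old potential is that of a full turn, which is 0. *)
Lemma rotor_potential_step x r : rotor_configuration succ r ->
  x \notin [:: b; c] ->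
  rotor_potential x (rotor_update succ x r x) - rotor_potential x (r x) =
  h x - h (successor succ x (rotor_update succ x r x)).
Proof.
move=> hr xbc; rewrite /rotor_update eqxx; case: (ltnP (r x)) => [rx|rx].
  rewrite /rotor_potential (take_nth x)// -cats1 big_cat/= big_seq1.
  by rewrite addrAC subrr add0r.
have -> : r x = degree succ x.
  by apply/eqP; rewrite eqn_leq rx andbT; case/andP: (hr x).
rewrite rotor_potential_turn// subr0 /rotor_potential (take_nth x (succ_gt0 x)).
by rewrite take0 /= big_seq1.
Qed.

Section Walk.
Variable r : V -> nat.
Hypothesis hr : rotor_configuration succ r.
Let x t := (rotor_walk succ a r t).1.
Let rho t := (rotor_walk succ a r t).2.

Lemma rotor_walk_configuration t : rotor_configuration succ (rho t).
Proof.
elim: t => [|t IH] //; rewrite /rho /rotor_walk iterS.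
exact: rotor_update_configuration.
Qed.

Lemma rotor_stable v t : x t != v -> rho t.+1 v = rho t v.
Proof. by rewrite eq_sym /rho /= /rotor_update => /negbTE ->. Qed.

Lemma rotor_eventually_stable v N t : (forall s, (N <= s)%N -> x s != v) ->
  (N <= t)%N -> rho t v = rho N v.
Proof.
move=> xv; elim: t => [|t IH]; first by rewrite leqn0 => /eqP ->.
rewrite leq_eqVlt => /predU1P[<-//|]; rewrite ltnS => Nt.
by rewrite rotor_stable ?IH// xv.
Qed.

Let Nv v t : R := \sum_(s < t) (x s == v)%:R.

Lemma rotor_bc v t : v \in [:: b; c] -> rho t v = 1%N.
Proof.
move=> /degree_bc dv; apply/eqP; rewrite eq_sym eqn_leq.
by have := rotor_walk_configuration t v; rewrite dv.
Qed.

(** Induction on [t]: only the rotor at [x t] moves, and off [b] and [c] its gain in potential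
    cancels the change of [h] along the step. *)
Lemma potential_balance (G : {fset V}) t :
  (forall s, (s < t)%N -> x s \in G) ->
  h (x t) - h a +
    \sum_(u <- G) (rotor_potential u (rho t u) - rotor_potential u (r u)) =
  Nv b t * (h a - 1) + Nv c t * h a.
Proof.
elim: t => [|t IH] xG.
  rewrite /Nv !big_ord0 !mul0r addr0 subrr add0r big1// => u _.
  by rewrite subrr.
have xtG : x t \in G by exact: xG.
have {}IH := IH (fun s st => xG s (ltnW st)).
have rE u : u != x t -> rho t.+1 u = rho t u.
  by rewrite eq_sym; exact: rotor_stable.
rewrite /Nv !big_ord_recr /= -/(Nv b t) -/(Nv c t) !mulrDl addrACA -IH.
rewrite (big_fsetD1 _ xtG)/= (big_fsetD1 _ xtG)/=.
have -> : \sum_(u <- (G `\ x t)%fset)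
      (rotor_potential u (rho t.+1 u) - rotor_potential u (r u)) =
    \sum_(u <- (G `\ x t)%fset)
      (rotor_potential u (rho t u) - rotor_potential u (r u)).
  rewrite big_seq [RHS]big_seq; apply: eq_bigr => u.
  by rewrite !inE => /andP[ut _]; rewrite rE.
have x1E : x t.+1 = successor succ (x t) (rho t.+1 (x t)) by [].
have [xbc|xbc] := boolP (x t \in [:: b; c]).
  (* At [b] and [c] the rotor stays at position 1 and the walk moves to [a], so only [h] changes: by
     [h a - 1] from [b], by [h a] from [c]. *)
  rewrite x1E !rotor_bc// successor_bc//.
  move: xbc; rewrite !inE => /orP[|] /eqP ->.
    by rewrite eqxx (negbTE bc_neq) hb /=; ring.
  by rewrite eqxx (eq_sym c) (negbTE bc_neq) hc /=; ring.
have := rotor_potential_step (rotor_walk_configuration t) xbc.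
rewrite -[rotor_update _ _ _]/(rho t.+1) -x1E => step.
move: xbc; rewrite !inE negb_or => /andP[/negbTE-> /negbTE->].
rewrite -[rotor_potential _ (rho t.+1 _)](subrK
  (rotor_potential (x t) (rho t (x t)))).
by rewrite step /=; ring.
Qed.

(** The exact balance holds over [F] enlarged by the vertices visited before [t]. The added rotors
    contribute at most their half variations, hence at most [delta], whatever [t] is; this
    uniformity is what survives a whole transient stage. *)
Lemma potential_balance_approx (F : {fset V}) (delta : R) t :
  (forall G : {fset V}, [disjoint F & G]%fset ->
     \sum_(u <- G) half_variation u <= delta) ->
  `|h (x t) - h a +
    \sum_(u <- F) (rotor_potential u (rho t u) - rotor_potential u (r u)) -
    (Nv b t * (h a - 1) + Nv c t * h a)| <= delta.
Proof.
move=> hF; pose G := [fset x (val s) | s in 'I_t]%fset.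
have xFG s : (s < t)%N -> x s \in (F `|` G)%fset.
  move=> st; rewrite inE; apply/orP; right.
  by apply/imfsetP; exists (Ordinal st).
rewrite -(potential_balance xFG).
rewrite sum_fsetU.
rewrite [X in `|X|](_ : _ = - \sum_(u <- (G `\` F)%fset)
  (rotor_potential u (rho t u) - rotor_potential u (r u))); last by ring.
rewrite normrN.
apply: le_trans (ler_norm_sum _ _ _) _.
apply: (@le_trans _ _ (\sum_(u <- (G `\` F)%fset) half_variation u)).
  apply: ler_sum => u _; have [ubc|ubc] := boolP (u \in [:: b; c]).
    rewrite (rotor_bc _ ubc) (rotor_bc 0 ubc : r u = 1%N) subrr normr0.
    exact: half_variation_ge0.
  exact: rotor_potential_bound.
by apply: hF; apply/fdisjointP => u uF; rewrite inE uF.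
Qed.
End Walk.

(** * Stages, visit counts and the balance across restarts *)

Section Transfinite.
Variable r0 : V -> nat.
Hypothesis hr0 : rotor_configuration succ r0.
Hypothesis hlimsup : forall eps : R, 0 < eps -> finite_set [set v | eps < h v].
Let x m t := transfinite_walk succ a r0 (m, t).
Let rho m t := (rotor_walk succ a (stage_config succ a r0 m) t).2.
Let transient_stage m := transient (x m).

Lemma transient_avoid (S : set V) m : transient_stage m -> finite_set S ->
  exists N, forall t, (N <= t)%N -> ~ S (x m t).
Proof.
move=> tr fS; have [N hN] : exists N, forall t, (N <= t)%N ->
    ~ (\bigcup_(v in S) [set t | x m t = v]) t.
  by apply: finite_nat_bounded; apply: bigcup_finite => // v _; exact: tr.
by exists N => t /hN St Sx; apply: St; exists (x m t).
Qed.

Lemma stage_config_lim m N v : (forall t, (N <= t)%N -> x m t != v) ->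
  stage_config succ a r0 m.+1 v = rho m N v.
Proof.
move=> xv; apply: lim_near_cst; first exact: discrete_hausdorff.
exists N => // t /=; exact: rotor_eventually_stable.
Qed.

Lemma stage_configuration m : (forall k, (k < m)%N -> transient_stage k) ->
  rotor_configuration succ (stage_config succ a r0 m).
Proof.
elim: m => [//|m IH] tr v.
have [N hN] := transient_avoid (tr m (leqnn _)) (finite_set1 v).
rewrite (@stage_config_lim m N) => [|t /hN xv]; last exact/eqP.
by apply: rotor_walk_configuration; apply: IH => k km; exact/tr/ltnW.
Qed.

(** Between times [(m, N)] and [(m.+1, 0)] lie only times of stage [m] from [N] on, none of them at
    [v]. This replaces the count at a limit time by one at an ordinary time. *)
Lemma visits_restart m N v : (forall t, (N <= t)%N -> x m t != v) ->
  visits succ a r0 (m.+1, 0%N) v = visits succ a r0 (m, N) v.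
Proof.
move=> xv; apply/seteqP; split=> -[k s] [+ kd xk];
  rewrite ltEprodlexi/= !leEnat !ltEnat/= => ks.
  split=> //; rewrite ltEprodlexi/= !leEnat !ltEnat/=.
  move: ks; rewrite ltn0 implybF -ltnNge ltnS => /andP[_ km]; rewrite km/=.
  apply/implyP => mk; have {km mk}km : k = m by apply/eqP; rewrite eqn_leq km.
  by rewrite ltnNge; apply/negP => /xv; rewrite -km /x xk eqxx.
split=> //; rewrite ltEprodlexi/= !leEnat !ltEnat/=.
by move: ks => /andP[km _]; rewrite ltn0 implybF -ltnNge ltnS km leqW.
Qed.

(** Transience of the earlier stages makes [(m, t)] a time at which the walk is defined, so that it
    may count as a visit. *)
Lemma visits_step m t v : (forall k, (k < m)%N -> transient_stage k) ->
  visits succ a r0 (m, t.+1) v =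
  (if x m t == v then [set (m, t)] else set0) `|` visits succ a r0 (m, t) v.
Proof.
move=> tr; apply/seteqP; split=> [[k s] [+ kd xk]|[k s] [|[kst kd xk]]].
- rewrite ltEprodlexi/= !leEnat !ltEnat/= => /andP[km ks].
  have [[kE sE]|kst] := pselect ((k, s) = (m, t)).
    by left; move: xk; rewrite /x kE sE => ->; rewrite eqxx.
  right; split=> //; rewrite ltEprodlexi/= !leEnat !ltEnat/= km/=.
  apply/implyP => mk; move: ks; rewrite mk /= ltnS leq_eqVlt => /predU1P[st|//].
  by case: kst; rewrite st; congr pair; apply/eqP; rewrite eqn_leq km.
- case: eqP => // xv [-> ->]; split=> //.
  by rewrite ltEprodlexi/= leEnat ltEnat/= !leqnn.
- split=> //; move: kst; rewrite !ltEprodlexi/= !leEnat !ltEnat/=.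
  by move=> /andP[-> /implyP ks]; apply/implyP => /ks /leqW.
Qed.

Lemma visits_start v : visits succ a r0 (0%N, 0%N) v = set0.
Proof.
apply/seteqP; split=> // -[k s] [+ _ _].
by rewrite ltEprodlexi/= !leEnat !ltEnat/= leqn0; case: eqP => // ->.
Qed.

Lemma visits_finite m t v : (forall k, (k < m)%N -> transient_stage k) ->
  finite_set (visits succ a r0 (m, t) v).
Proof.
elim: m t => [|m IHm] t tr; elim: t => [|t IHt].
- by rewrite visits_start.
- by rewrite visits_step// finite_setU; split=> //; case: ifP.
- have [N hN] := transient_avoid (tr m (leqnn _)) (finite_set1 v).
  rewrite (@visits_restart m N) => [|t /hN xv]; last exact/eqP.
  by apply: IHm => k km; exact/tr/ltnW.
- by rewrite visits_step// finite_setU; split=> //; case: ifP.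
Qed.

Lemma nvisits_step m t v : (forall k, (k < m)%N -> transient_stage k) ->
  nvisits succ a r0 (m, t.+1) v =
  ((x m t == v) + nvisits succ a r0 (m, t) v)%N.
Proof.
move=> tr; rewrite /nvisits visits_step//.
case: ifP => _; last by rewrite set0U.
rewrite fset_setU1 ?cardfsU1; last exact: visits_finite.
rewrite in_fset_set; last exact: visits_finite.
by case: (boolP (_ \in _)) => //; rewrite inE => -[]; rewrite ltxx.
Qed.

Lemma nvisits_stage m t v : (forall k, (k < m)%N -> transient_stage k) ->
  (nvisits succ a r0 (m, t) v)%:R =
  (nvisits succ a r0 (m, 0%N) v)%:R + \sum_(s < t) (x m s == v)%:R :> R.
Proof.
move=> tr; elim: t => [|t IH]; first by rewrite big_ord0 addr0.
by rewrite nvisits_step// natrD IH big_ord_recr /=; ring.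
Qed.

(** Strong induction: times of stage [k] count as visits only once all stages before [k] are known
    to be transient. The visits to [v] in stage [k] are then among the finitely many in [visits]. *)
Lemma finite_visits_transient m t :
  (forall v, finite_set (visits succ a r0 (m, t) v)) ->
  forall k, (k < m)%N -> transient_stage k.
Proof.
move=> fin; elim/ltn_ind => k IH km v.
apply: sub_finite_set (finite_image snd (fin v)) => s /= xs.
exists (k, s) => //; split=> //; last first.
  by move=> j /= jk; apply: IH => //; exact: ltn_trans km.
by rewrite ltEprodlexi/= !leEnat !ltEnat/= ltnW//= leqNgt km.
Qed.

Let nu v m t : R := (nvisits succ a r0 (m, t) v)%:R.

(** The defect of the balance since time 0 when only the rotors in [F] are followed; the term
    [m%:R * h a] accounts for the restarts. *)
Definition imbalance (F : {fset V}) m t : R :=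
  h (x m t) - h a +
  \sum_(u <- F) (rotor_potential u (rho m t u) - rotor_potential u (r0 u)) -
  (nu b m t * (h a - 1) + nu c m t * h a + m%:R * h a).

Section Bound.
Variables (F : {fset V}) (delta : R).
Hypothesis tailF : forall G : {fset V}, [disjoint F & G]%fset ->
  \sum_(u <- G) half_variation u <= delta.

Lemma imbalance_stage m t : (forall k, (k < m)%N -> transient_stage k) ->
  `|imbalance F m t| <= `|imbalance F m 0| + delta.
Proof.
move=> tr.
have := potential_balance_approx (stage_configuration tr) t tailF.
set D := (X in `|X|) => hD.
have -> : imbalance F m t = imbalance F m 0 + D.
  pose phi i u := rotor_potential u (rho m i u).
  have sumE : \sum_(u <- F) (phi t u - rotor_potential u (r0 u)) =
      \sum_(u <- F) (phi 0%N u - rotor_potential u (r0 u)) +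
      \sum_(u <- F) (phi t u - phi 0%N u).
    by rewrite -big_split; apply: eq_bigr => u _ /=; ring.
  rewrite /imbalance sumE /nu !(nvisits_stage t)//.
  by rewrite /D /x /transfinite_walk /=; ring.
by apply: le_trans (ler_normD _ _) _; rewrite lerD2l.
Qed.

(** Late in stage [m] the rotors in [F] and the counts at [b] and [c] have their final values.
    Restarting replaces [h (x m N)] by [h a] and adds one [h a] to the other side, so the defect
    changes by [h (x m N)], which is arbitrarily small. *)
Lemma imbalance_restart m : (forall k, (k <= m)%N -> transient_stage k) ->
  `|imbalance F m.+1 0| <= `|imbalance F m 0| + delta.
Proof.
move=> tr; apply/ler_addgt0Pr => eta eta0.
(* Leaving this finite set for good freezes the followed rotors and the two counts, and forces [h]
   to be at most [eta]. *)
have fS : finite_set ([set` F] `|` [set b; c] `|` [set v | eta < h v]).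
  rewrite !finite_setU; split; last exact: hlimsup.
  by split; [exact: finite_fset|split; exact: finite_set1].
have [N hN] := transient_avoid (tr m (leqnn _)) fS.
have avoid v : v \in F \/ v \in [:: b; c] -> forall t, (N <= t)%N -> x m t != v.
  move=> vF t /hN xS; apply/eqP => xv; apply: xS; rewrite xv; left.
  case: vF => [vF|]; first by left.
  by rewrite !inE => /orP[] /eqP ->; right; [left|right].
have tr' k : (k < m)%N -> transient_stage k by move=> /ltnW; exact: tr.
have -> : imbalance F m.+1 0 = imbalance F m N - h (x m N).
  rewrite /imbalance [x m.+1 0%N]/x /transfinite_walk /= /nu /nvisits.
  rewrite !(@visits_restart m N);
    [|apply: avoid; right; rewrite !inE eqxx ?orbT//..].
  rewrite -(@eq_big_seq _ _ _ _ F
    (fun u => rotor_potential u (rho m N u) - rotor_potential u (r0 u))).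
    by rewrite -natr1; ring.
  by move=> u uF; rewrite -(stage_config_lim (avoid u (or_introl uF))).
apply: le_trans (ler_normB _ _) _; rewrite lerD ?imbalance_stage//.
by rewrite ger0_norm// leNgt; apply/negP => hx; apply: (hN N) => //; right.
Qed.

(** The defect is 0 at the start and grows by at most [delta] in each of the [m] completed stages
    and in the current one. *)
Lemma imbalance_bound m t : (forall k, (k < m)%N -> transient_stage k) ->
  `|imbalance F m t| <= m.+1%:R * delta.
Proof.
move=> tr; rewrite -natr1 mulrDl mul1r.
apply: le_trans (imbalance_stage t tr) _.
rewrite lerD2r; elim: m tr => [|m IH] tr.
  rewrite /imbalance /x /transfinite_walk /rho /= subrr add0r.
  rewrite big1 => [|u _]; last by rewrite subrr.
  have nu0 v : nu v 0 0 = 0 by rewrite /nu /nvisits visits_start fset_set0.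
  by rewrite !nu0 !mul0r !addr0 subrr normr0.
rewrite -natr1 mulrDl mul1r; apply: le_trans (imbalance_restart tr) _.
by rewrite lerD2r; apply: IH => k km; exact/tr/ltnW.
Qed.
End Bound.

(** [F] comes within [delta] of the supremum of the finite sums, so a disjoint set cannot add more
    than [delta]. *)
Lemma half_variation_tail (K delta : R) :
  (forall G : {fset V}, \sum_(u <- G) half_variation u <= K) -> 0 < delta ->
  exists F : {fset V}, forall G : {fset V}, [disjoint F & G]%fset ->
    \sum_(u <- G) half_variation u <= delta.
Proof.
move=> hK delta0.
pose E := [set \sum_(u <- G) half_variation u | G in [set: {fset V}]].
have supE : has_sup E.
  split; first by exists (\sum_(u <- fset0) half_variation u), fset0.
  by exists K => _ [G _ <-]; exact: hK.
have [_ [F _ <-] ltF] := sup_adherent delta0 supE.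
exists F => G FG; have : \sum_(u <- (F `|` G)%fset) half_variation u <= sup E.
  by apply: ub_le_sup; [case: supE|exists (F `|` G)%fset].
rewrite sum_fsetU (fsetDidPl _ _ _); last by rewrite fdisjoint_sym.
lra.
Qed.

(** The 1 bounds [h (x m t) - h a], since [h] takes values between 0 and 1, and [K] bounds the
    change of the potentials over [F]; the truncation error is arbitrarily small. *)
Lemma discrepancy_bound (K : R) m t :
  (forall v, h v <= 1) ->
  (forall G : {fset V}, \sum_(u <- G) half_variation u <= K) ->
  (forall k, (k < m)%N -> transient_stage k) ->
  `|(nu b m t + nu c m t + m%:R) * h a - nu b m t| <= 1 + K.
Proof.
move=> h_le1 hK tr; apply/ler_addgt0Pr => e e0.
(* With [m.+1] stages involved, this tolerance gives a total error of at most [e]. *)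
have [|F tailF] := half_variation_tail hK (delta := e / m.+1%:R).
  by rewrite divr_gt0.
have := imbalance_bound tailF t tr; rewrite mulrCA mulfV// mulr1.
have : `|\sum_(u <- F)
    (rotor_potential u (rho m t u) - rotor_potential u (r0 u))| <= K.
  apply: le_trans (ler_norm_sum _ _ _) _; apply: le_trans (hK F).
  apply: ler_sum => u _; have [ubc|ubc] := boolP (u \in [:: b; c]).
    rewrite /rho (rotor_bc (stage_configuration tr) t ubc).
    by rewrite -(rotor_bc hr0 0 ubc) subrr normr0 half_variation_ge0.
  exact: rotor_potential_bound.
rewrite /imbalance; have := h_ge0 a; have := h_ge0 (x m t).
have := h_le1 a; have := h_le1 (x m t); move: (\sum_(u <- F) _) => S.
rewrite !ler_norml => ? ? ? ? /andP[? ?] /andP[? ?].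
apply/andP; split; lra.
Qed.
End Transfinite.
End RotorPotential.

(** * Comparison with [K1] and conclusion *)

Lemma half_variation_le_K1 (R : realType) (V : countType) (p : V -> V -> R)
    (succ : V -> seq V) (h : V -> R) (b c : V) (G : {fset V}) :
  rotor_mechanism succ p -> (K1 succ p h b c < +oo)%E ->
  \sum_(u <- G) half_variation succ h b c u <= fine (K1 succ p h b c) - 1.
Proof.
move=> hsucc; rewrite /K1; set I := (X in \esum_(_ in X) _).
set f := fun uv : V * V =>
  ((degree succ uv.1)%:R * p uv.1 uv.2 * `|h uv.1 - h uv.2|)%:E.
pose S := \sum_(u <- G) half_variation succ h b c u; rewrite -/S.
have p_ge0 u v : 0 <= p u v by rewrite hsucc.2 divr_ge0.
have f_ge0 uv : (0 <= f uv)%E by rewrite lee_fin !mulr_ge0.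
pose G' := [seq u <- G | u \notin [:: b; c]].
(* Each pair must occur once, as in the sum defining [K1]; the multiplicity of [v] in [succ u] is
   carried by the factor [d(u) p(u,v)]. *)
pose s := [seq (u, v) | u <- G', v <- undup (succ u)].
have uniq_s : uniq s.
  apply: allpairs_uniq_dep => [|u _|[u v] [u' v'] _ _ [-> ->]//].
    by rewrite filter_uniq// fset_uniq.
  exact: undup_uniq.
have sum_s : (\sum_(uv <- s) f uv = (2 * S)%:E)%E.
  rewrite big_allpairs_dep big_filter /S mulr_sumr -sumEFin.
  rewrite [RHS](bigID (fun u => u \notin [:: b; c]))/=.
  rewrite [X in (_ + X)%E]big1; last first.
    by move=> u; rewrite negbK /half_variation => ->; rewrite mulr0.
  rewrite adde0; apply: eq_bigr => u ubc.
  have d0 : (degree succ u)%:R != 0 :> R by rewrite pnatr_eq0 -lt0n hsucc.1.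
  rewrite /half_variation (negbTE ubc) mulrA mulfV// mul1r sumEFin.
  congr (_%:E).
  rewrite -[RHS](mulfVK d0) (sum_succ hsucc) mulr_suml.
  by apply: eq_bigr => v _ /=; ring.
have le_esum : ((2 * S)%:E <= \esum_(uv in I) f uv)%E.
  apply: esum_ge; exists [set` s]; last by rewrite -fsbig_seq// sum_s.
  split; first exact: finite_seq.
  move=> _ /= /allpairsPdep[u [v [uG _ ->]]]; split=> //= ubc.
  move: uG; rewrite mem_filter => /andP[+ _]; rewrite !inE negb_or.
  by case: ubc => ->; rewrite eqxx ?andbF.
have : (0 <= \esum_(uv in I) f uv)%E by exact: esum_ge0.
move: le_esum; case: (\esum_(uv in I) f uv)%E => [e| |]//.
  by rewrite /= !lee_fin => le_e _ _; lra.
(* An infinite sum would make [K1] infinite, against the hypothesis. *)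
by move=> _ _; rewrite mulry gtr0_sg ?invr_gt0// mul1e.
Qed.

Theorem theorem8 (R : realType) (V : countType) (p : V -> V -> R)
    (hp : transition_probabilities p)
    (d : measure_display) (T : measurableType d)
    (P : V -> probability T R) (X : nat -> T -> V)
    (hX : forall u : V, markov_chain (P u) X p u)
    (succ : V -> seq V) (hsucc : rotor_mechanism succ p)
    (a b c : V) (hab : a != b) (hac : a != c) (hbc : b != c)
    (hpb : p b a = 1) (hpc : p c a = 1)
    (hdb : degree succ b = 1%N) (hdc : degree succ c = 1%N)
    (hsb : successor succ b 1 = a) (hsc : successor succ c 1 = a)
    (h : V -> R) (hh : forall v : V, h v = hit_before P X b c v)
    (hK1 : (K1 succ p h b c < +oo)%E)
    (hirr : irreducible p)
    (hlimsup : forall eps : R, 0 < eps -> finite_set [set v | eps < h v])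
    (r0 : V -> nat) (hr0 : rotor_configuration succ r0)
    (m t : nat)
    (hfin : forall v : V, finite_set (visits succ a r0 (m, t) v))
    (hpos : (0 < nvisits succ a r0 (m, t) b + nvisits succ a r0 (m, t) c + m)%N) :
  `| h a - (nvisits succ a r0 (m, t) b)%:R /
       (nvisits succ a r0 (m, t) b + nvisits succ a r0 (m, t) c + m)%:R |
  <= fine (K1 succ p h b c) /
       (nvisits succ a r0 (m, t) b + nvisits succ a r0 (m, t) c + m)%:R.
Proof.
have hE : h = hit_before P X b c by apply/funext.
have h_ge0 v : 0 <= h v by rewrite hE hit_before_ge0.
have h_le1 v : h v <= 1 by rewrite hE (hit_before_le1 hX).
have hb : h b = 1 by rewrite hE (hit_before_at hsucc hX)// ?eqxx// inE eqxx.
have hc : h c = 0.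
  rewrite hE (hit_before_at hsucc hX)// ?inE ?eqxx ?orbT//.
  by rewrite eq_sym (negbTE hbc).
have harm u : u \notin [:: b; c] ->
    \sum_(v <- succ u) h v = (degree succ u)%:R * h u.
  by rewrite hE; exact: (hit_before_harmonic hsucc hX hbc).
have dbc u : u \in [:: b; c] -> degree succ u = 1%N.
  by rewrite !inE => /orP[] /eqP ->.
have sbc u : u \in [:: b; c] -> successor succ u 1 = a.
  by rewrite !inE => /orP[] /eqP ->.
have tr := finite_visits_transient hfin.
have := discrepancy_bound hsucc.1 h_ge0 harm hb hc hbc dbc sbc hr0 hlimsup t
  h_le1 (fun G => half_variation_le_K1 G hsucc hK1) tr.
(* The 1 of the discrepancy bound is the leading 1 in the definition of [K1], so the bound is
   exactly [K1]; it remains to divide by the positive count. *)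
rewrite -!natrD [1 + _]addrC subrK => bound.
have N_gt0 : (0 : R) <
    (nvisits succ a r0 (m, t) b + nvisits succ a r0 (m, t) c + m)%:R.
  by rewrite ltr0n.
rewrite -[X in `|X - _|](mulfK (lt0r_neq0 N_gt0)) -mulrBl normrM normfV.
rewrite (gtr0_norm N_gt0) ler_pM2r ?invr_gt0//.
by rewrite [h a * _]mulrC.
Qed.
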